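(* Let $X$ be an integrable random variable, $N\sim\mathcal{N}(0,1)$ independent of $X$, $Y=X+N$, and $f(y)=\mathbb{E}[X\mid Y=y]$. Let $r\ge2$ be an integer, $q_r=\lfloor(\sqrt{8r+9}-3)/2\rfloor$ and $\gamma_r=((2rq_r)!)^{1/(4q_r)}$. Then $$\big\|f^{(r-1)}(Y)\big\|_{2}\le 2^rC_r\min\big(\gamma_r,\ \|X\|_{2rq_r}^r\big).$$
   Context: $f$ is the smooth version $f(y)=\mathbb{E}[Xe^{-(X-y)^2/2}]/\mathbb{E}[e^{-(X-y)^2/2}]$, and $\|Z\|_q=(\mathbb{E}|Z|^q)^{1/q}$. Let $\Pi_r$ be the set of integer partitions of $r$ into parts each $\ge2$, encoded by multiplicities $\boldsymbol{\lambda}=(\lambda_2,\dots,\lambda_\ell)$ with $2\lambda_2+\dots+\ell\lambda_\ell=r$; for such $\boldsymbol{\lambda}$ with $m=\lambda_2+\dots+\lambda_\ell$ parts, $c_{\boldsymbol{\lambda}}=\frac1m\binom{m}{\lambda_2,\dots,\lambda_\ell}\binom{r}{2,\dots,2;\dots;\ell,\dots,\ell}$ (the second multinomial has $\lambda_k$ entries equal to $k$ for each $k$), and $C_r=\sum_{\boldsymbol{\lambda}\in\Pi_r}c_{\boldsymbol{\lambda}}$. *)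

(* Defs.v *)
From HB Require Import structures.
From mathcomp Require Import all_boot all_order all_algebra.
From mathcomp Require Import all_classical all_reals all_analysis.
Set Implicit Arguments. Unset Strict Implicit. Unset Printing Implicit Defensive.
Import Order.TTheory GRing.Theory Num.Theory.
Import numFieldNormedType.Exports.
Local Open Scope classical_set_scope.
Local Open Scope ring_scope.

(* smooth version of the conditional mean E[X | X + N = y] *)
Definition smoothf d (T : measurableType d) (R : realType)
  (P : probability T R) (X : T -> R) (y : R) : R :=
  Rintegral P setT (fun w => X w * expR (- (X w - y) ^+ 2 / 2)) /
  Rintegral P setT (fun w => expR (- (X w - y) ^+ 2 / 2)).

Definition indep_rv d (T : measurableType d) (R : realType)
  (P : probability T R) (X N : T -> R) : Prop :=
  forall A B : set R, measurable A -> measurable B ->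
    P (X @^-1` A `&` N @^-1` B) = (P (X @^-1` A) * P (N @^-1` B))%E.

(* Partitions of r into parts >= 2, encoded by multiplicities l k
   (k = 0..r), with l 0 = l 1 = 0 and sum_k k * l k = r. *)
Definition is_part_ge2 (r : nat) (l : {ffun 'I_r.+1 -> 'I_r.+1}) : bool :=
  [forall k : 'I_r.+1, ((k : nat) < 2)%N ==> (l k == ord0)] &&
  ((\sum_(k < r.+1) k * l k)%N == r).

Definition nparts (r : nat) (l : {ffun 'I_r.+1 -> 'I_r.+1}) : nat :=
  (\sum_(k < r.+1) l k)%N.

(* c_lambda = (1/m) * multinomial(m; l_2..l_r) * multinomial(r; 2,..,2;...;r,..,r) *)
Definition c_lambda (R : realType) (r : nat) (l : {ffun 'I_r.+1 -> 'I_r.+1}) : R :=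
  (nparts l)%:R^-1 *
  ((nparts l)`!%:R / (\prod_(k < r.+1) (l k)`!)%:R) *
  (r`!%:R / (\prod_(k < r.+1) (k`! ^ l k))%:R).

Definition C_const (R : realType) (r : nat) : R :=
  \sum_(l : {ffun 'I_r.+1 -> 'I_r.+1} | is_part_ge2 l) c_lambda R l.

Definition q_r (R : realType) (r : nat) : nat :=
  Num.truncn ((Num.sqrt (8 * r%:R + 9 : R) - 3) / 2).

Definition gamma_r (R : realType) (r : nat) : R :=
  ((2 * r * q_r R r)`!)%:R `^ (4 * (q_r R r)%:R)^-1.

(* Main.v *)
(** By Tweedie's formula [smoothf^(r-1) y] is the [r]-th cumulant of [X] under the
    law [nu_y] with density proportional to [exp (- (X - y)^2 / 2)].  Expressed
    in central moments, the absolute values of its coefficients sum to [C_r],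
    and [|mu_k| <= b^k] as soon as [E (X - E X)^(2r) <= b^(2r)]; hence
    [smoothf^(r-1)(y)^2 <= C_r^2 E (X - E X)^(2r) <= C_r^2 4^r E (X - a)^(2r)]
    under [nu_y], for every real [a].  Integrating against the density of
    [X + N] with [a = 0] gives [E X^(2r)], and with [a = y] gives [E N^(2r)].

    No partition is ever expanded in the cumulants: [C_r / r!] is the coefficient of
    [t^r] in [- log (1 - (e^t - 1 - t))], so the numbers [C_n] satisfy the
    recurrence of the cumulants with all moments of order at least 2 replaced
    by 1 and all signs made positive.

    Of [q_r] only [q_r >= 1] matters: the moments of order [2r] are bounded by
    Lyapunov's inequality and by [(E N^(2r))^(2q) <= (2r)!^q <= (2rq)!]. *)

Require Import Defs.
From HB Require Import structures.
From mathcomp Require Import all_boot all_order all_algebra.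
From mathcomp Require Import all_classical all_reals all_analysis.
From mathcomp Require Import measurable_realfun ring lra.
Import Order.TTheory GRing.Theory Num.Theory.
Import numFieldNormedType.Exports.
Local Open Scope classical_set_scope.
Local Open Scope ring_scope.

Set Implicit Arguments.
Unset Strict Implicit.
Unset Printing Implicit Defensive.

(** * The recurrence for [C_r] *)

Lemma factr_neq0 (R : numFieldType) n : n`!%:R != 0 :> R.
Proof. by rewrite pnatr_eq0 -lt0n fact_gt0. Qed.

Lemma binr_fact (R : numFieldType) n j : (j <= n)%N ->
  'C(n, j)%:R = n`!%:R / (j`!%:R * (n - j)`!%:R) :> R.
Proof.
by move=> jn; rewrite -(bin_fact jn) !natrM mulfK ?mulf_neq0 ?factr_neq0.
Qed.

(** The truncated series of [exp (a s)] in an outer variable [s], which will count blocks; its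
    coefficients are polynomials in the inner variable [t]. *)
Definition exp_trunc (R : numFieldType) (M : nat) (a : {poly R}) : {poly {poly R}} :=
  \poly_(j < M) (j`!%:R^-1 *: a ^+ j).

(** Exponentials multiply by adding their exponents, and truncation leaves the coefficients below
    [M] intact. *)
Lemma coef_prod_exp_trunc (R : numFieldType) M K (a : 'I_K -> {poly R}) i :
  (i < M)%N ->
  (\prod_k exp_trunc M (a k))`_i = i`!%:R^-1 *: (\sum_k a k) ^+ i.
Proof.
elim: K a i => [|K IH] a i iM.
  rewrite !big_ord0 coef1 expr0n; case: i iM => [|i] _ /=.
    by rewrite invr1 scale1r.
  by rewrite scaler0.
rewrite !big_ord_recr /= coefMr exprDn scaler_sumr.
apply: eq_bigr => -[j /=]; rewrite ltnS => ji _.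
rewrite IH; last exact: leq_ltn_trans (leq_subr _ _) iM.
rewrite /exp_trunc coef_poly (leq_ltn_trans ji iM).
rewrite -scalerAl -scalerAr scalerA -[_ *+ 'C(_, _)]scaler_nat scalerA.
congr (_ *: _).
rewrite (binr_fact R ji).
by field; rewrite !factr_neq0.
Qed.

(** Obtained by distributing the product of exponentials and reading off one coefficient. Exponents
    live in ['I_M], so that the index set has the finite function type encoding partitions. *)
Lemma multinomialr (R : numFieldType) M K (a : 'I_K -> {poly R}) i :
  (i < M)%N ->
  i`!%:R^-1 *: (\sum_k a k) ^+ i =
  \sum_(f : {ffun 'I_K -> 'I_M} | (\sum_k f k == i)%N)
     \prod_k ((f k)`!%:R^-1 *: a k ^+ f k).
Proof.
move=> iM; rewrite -(coef_prod_exp_trunc a iM) /exp_trunc.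
under eq_bigr do rewrite poly_def.
rewrite bigA_distr_bigA /= coef_sum [RHS]big_mkcond /=.
apply: eq_bigr => f _.
under eq_bigr do rewrite -mul_polyC.
rewrite big_split /= -rmorph_prod /= coefCM.
rewrite prodrXr coefXn eq_sym.
by case: eqP => _; rewrite ?mulr1 ?mulr0.
Qed.

Definition block_term (R : numFieldType) (k : nat) : {poly R} :=
  if (2 <= k)%N then k`!%:R^-1 *: 'X^k else 0.

Definition block_poly (R : numFieldType) (r : nat) : {poly R} :=
  \sum_(k < r.+1) block_term R k.

(* [log_poly r] is [- log (1 - (e^t - 1 - t))], with both series truncated so that
   only the coefficients of degree at most [r] are meaningful. *)
Definition log_poly (R : numFieldType) (r : nat) : {poly R} :=
  \sum_(1 <= m < r.+1) m%:R^-1 *: block_poly R r ^+ m.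

(** A positive exponent on a block of size below 2 gives the factor 0, a zero exponent the factor
    [0 ^ 0 = 1]. What survives is a monomial of degree [sum_k k * f k], so the coefficient of degree
    [r] selects the partitions of [r]. *)
Lemma coef_prod_block (R : numFieldType) r (f : {ffun 'I_r.+1 -> 'I_r.+1}) :
  (\prod_k ((f k)`!%:R^-1 *: block_term R k ^+ f k))`_r =
  if is_part_ge2 f then
    (\prod_k (f k)`!)%:R^-1 * (\prod_(k < r.+1) k`! ^ f k)%:R^-1
  else 0.
Proof.
rewrite /is_part_ge2; case: (boolP [forall k, _]) => [/forallP f2|]; last first.
  rewrite negb_forall => /existsP[k]; rewrite negb_imply => /andP[k2 fk].
  rewrite (bigD1 k) //= /block_term leqNgt k2 /= expr0n.
  by rewrite -val_eqE /= in fk; rewrite (negPf fk) scaler0 mul0r coef0.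
under eq_bigr => k _.
  have -> : block_term R k ^+ f k = (k`! ^ f k)%:R^-1 *: 'X^(k * f k).
    rewrite /block_term; case: ifPn => k2.
      by rewrite exprZn -exprM natrX exprVn.
    have /eqP -> : f k == ord0 by apply: (implyP (f2 k)); rewrite ltnNge.
    by rewrite muln0 !expr0 expn0 invr1 scale1r.
  rewrite scalerA; over.
rewrite scaler_prod coefZ prodrXr coefXn eq_sym.
case: eqP => _ /=; last by rewrite mulr0.
by rewrite mulr1 big_split /= !prodfV !natr_prod.
Qed.

Lemma nparts_bounds r (f : {ffun 'I_r.+1 -> 'I_r.+1}) :
  (0 < r)%N -> is_part_ge2 f -> (1 <= nparts f < r.+1)%N.
Proof.
move=> r0 /andP[/forallP f2 /eqP fr]; rewrite /nparts ltnS; apply/andP; split.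
  rewrite lt0n; apply/eqP => /eqP; rewrite sum_nat_eq0 => /forallP f0.
  move: r0; rewrite -{1}fr big1 // => k _.
  by have /implyP/(_ isT)/eqP -> := f0 k; rewrite muln0.
rewrite -[leqRHS]fr; apply: leq_sum => k _.
have [k2|k2] := leqP 2 k; first by rewrite leq_pmull // (leq_trans _ k2).
by have /implyP/(_ k2)/eqP -> := f2 k.
Qed.

(** Sort the partitions by their number [m] of parts: the [m]-th power of the block series yields
    both multinomials, and the logarithm supplies the factor [1 / m]. By [nparts_bounds] every
    partition is met by exactly one [m]. *)
Lemma C_constE (R : realType) r : (0 < r)%N ->
  C_const R r = r`!%:R * (log_poly R r)`_r.
Proof.
move=> r0; rewrite /log_poly coef_sum mulr_sumr.
have step m : (1 <= m < r.+1)%N ->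
    r`!%:R * (m%:R^-1 *: block_poly R r ^+ m)`_r =
    \sum_(f : {ffun 'I_r.+1 -> 'I_r.+1})
       if m == nparts f then (if is_part_ge2 f then c_lambda R f else 0) else 0.
  move=> /andP[m1 mr].
  have m0 : m%:R != 0 :> R by rewrite pnatr_eq0 -lt0n.
  have -> : block_poly R r ^+ m = m`!%:R *: (m`!%:R^-1 *: block_poly R r ^+ m).
    by rewrite scalerA divff ?factr_neq0 // scale1r.
  rewrite (multinomialr _ mr) !coefZ coef_sum big_mkcond /= !mulr_sumr.
  apply: eq_bigr => f _; rewrite -[(\sum_k f k)%N]/(nparts f) eq_sym.
  have [mE|_] := eqVneq; last by rewrite !mulr0.
  rewrite coef_prod_block; case: ifP => _; last by rewrite !mulr0.
  rewrite /c_lambda -mE; ring.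
rewrite (eq_big_nat _ _ step) exchange_big /= /C_const big_mkcond /=.
apply: eq_bigr => f _; rewrite -big_mkcond /= big_nat1_eq.
by case: ifPn => fp; [rewrite nparts_bounds | case: ifP].
Qed.

(** The truncation order [r] stays fixed while [n] varies, so that the recurrence concerns a single
    polynomial; for [r > 0] the value at [n = r] is [C_r]. *)
Definition log_coef (R : numFieldType) r n : R := n`!%:R * (log_poly R r)`_n.

Lemma coef_block_poly (R : numFieldType) r n : (n <= r)%N ->
  (block_poly R r)`_n = if (2 <= n)%N then n`!%:R^-1 else 0.
Proof.
move=> nr; rewrite /block_poly coef_sum (bigD1 (inord n)) //= inordK ?ltnS //.
rewrite /block_term; case: ifP => n2.
  rewrite coefZ coefXn eqxx mulr1 big1 ?addr0 // => k.
  rewrite -val_eqE /= inordK ?ltnS // => kn; case: ifP => _; rewrite ?coef0 //.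
  by rewrite coefZ coefXn eq_sym (negPf kn) mulr0.
rewrite coef0 add0r big1 // => k.
rewrite -val_eqE /= inordK ?ltnS // => kn; case: ifP => _; rewrite ?coef0 //.
by rewrite coefZ coefXn eq_sym (negPf kn) mulr0.
Qed.

(* Differentiating [G = sum_(1 <= m <= r) p^m / m] gives
   [G' = p' + G' p - p' p^r], and [p^r] has no term of degree below [r]. *)
Lemma deriv_log_poly (R : numFieldType) r :
  (log_poly R r)^`() = (block_poly R r)^`() + (log_poly R r)^`() * block_poly R r
     - (block_poly R r)^`() * block_poly R r ^+ r.
Proof.
set p := block_poly R r.
have -> : (log_poly R r)^`() = p^`() * \sum_(m < r) p ^+ m.
  rewrite /log_poly raddf_sum mulr_sumr big_add1 /= big_mkord.
  apply: eq_bigr => m _; rewrite derivZ deriv_exp -/p.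
  by rewrite -scalerMnr scalerMnl -mulr_natr mulVf ?pnatr_eq0 // scale1r.
have := subrX1 p r; set S := \sum_(m < r) _ => pS.
have -> : p ^+ r = 1 + (p - 1) * S by rewrite -pS; ring.
by ring.
Qed.

(** This is [n!] times the coefficient of [t^n] in [deriv_log_poly]. The lone derivative of the
    block series contributes 1, except at [n = 0], because that series has no linear term. *)
Lemma log_coef_rec (R : numFieldType) r n : (n < r)%N ->
  log_coef R r n.+1 = (0 < n)%N%:R +
    \sum_(j < n.+1 | (2 <= n - j)%N) 'C(n, j)%:R * log_coef R r j.+1.
Proof.
move=> nr; have := congr1 (fun q : {poly R} => n`!%:R * q`_n) (deriv_log_poly R r).
rewrite coefB coefD !coef_deriv coefM coef_block_poly //.
have -> : ((block_poly R r)^`() * block_poly R r ^+ r)`_n = 0.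
  have [q ->] : exists q, block_poly R r = 'X * q.
    exists (\sum_(k < r.+1) if (2 <= k)%N then k`!%:R^-1 *: 'X^(k.-1) else 0).
    rewrite /block_poly mulr_sumr; apply: eq_bigr => k _; rewrite /block_term.
    case: ifP => k2; last by rewrite mulr0.
    by rewrite -scalerAr -exprS prednK // (leq_trans _ k2).
  by rewrite exprMn mulrCA mulrC coefMXn nr.
rewrite subr0 mulrDr => H.
have -> : log_coef R r n.+1 = n`!%:R * ((log_poly R r)`_n.+1 *+ n.+1).
  by rewrite /log_coef factS natrM -[_ *+ _]mulr_natl; ring.
rewrite H; congr (_ + _).
  case: n nr {H} => [|n] nr; first by rewrite mulr0n mulr0.
  rewrite /= [n.+2`!]factS [(n.+2 * _)%:R]natrM -[_ *+ n.+2]mulr_natr.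
  by field; rewrite factr_neq0 -natrD pnatr_eq0.
rewrite mulr_sumr [RHS]big_mkcond /=; apply: eq_bigr => -[j /= jn] _.
rewrite ltnS in jn; rewrite coef_deriv coef_block_poly; last first.
  by rewrite (leq_trans (leq_subr _ _)) // ltnW.
case: ifP => _; last by rewrite !mulr0.
rewrite (binr_fact R jn) /log_coef factS natrM -[_ *+ j.+1]mulr_natr.
by field; rewrite !factr_neq0.
Qed.

(** * Cumulants *)

(** Pascal's rule in the form that turns the termwise derivative of one Leibniz sum into the next
    Leibniz sum. *)
Lemma leibniz_pascal (R : comNzRingType) (a b : nat -> R) n :
  \sum_(j < n.+2) 'C(n.+1, j)%:R * a j * b (n.+1 - j)%N =
  \sum_(j < n.+1) 'C(n, j)%:R * (a j.+1 * b (n - j)%N + a j * b (n.+1 - j)%N).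
Proof.
under [RHS]eq_bigr do rewrite mulrDr.
rewrite [RHS]big_split /= big_ord_recl /= bin0 subn0.
under eq_bigr => j _ do rewrite /bump /= add1n binS natrD mulrDl mulrDl subSS.
rewrite big_split /= addrA addrC; congr (_ + _).
  by apply: eq_bigr => j _; rewrite mulrA.
rewrite [RHS]big_ord_recl /= bin0 subn0 mulrA; congr (_ + _).
rewrite big_ord_recr /= bin_small // mul0r mul0r addr0.
by apply: eq_bigr => j _; rewrite /bump /= add1n subSS mulrA.
Qed.

(** Here [h] is the logarithmic derivative of [Q 0], so its derivatives are cumulants when the [Q k]
    are moments. The identity is Leibniz's rule for [Q 1 = h * Q 0]; smoothness of [h] is proved
    along with it. *)
Lemma leibniz_quotient (R : realType) (Q : nat -> R -> R) (h : R -> R) :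
  (forall k (y : R), is_derive y 1 (Q k) (Q k.+1 y)) ->
  (forall y, Q 0%N y != 0) -> (forall y, Q 1%N y = h y * Q 0%N y) ->
  forall n, (forall y, derivable (derive1n n h) y 1) /\
    (forall y, Q n.+1 y =
       \sum_(j < n.+1) 'C(n, j)%:R * derive1n j h y * Q (n - j)%N y).
Proof.
move=> dQ Q0 Q1 n.
(* The induction differentiates every term of the sum, so derivability is carried for all orders up
   to [n]. *)
suff: (forall j y, (j <= n)%N -> derivable (derive1n j h) y 1) /\
    (forall y, Q n.+1 y =
       \sum_(j < n.+1) 'C(n, j)%:R * derive1n j h y * Q (n - j)%N y).
  by move=> [H1 H2]; split => // y; exact: H1.
elim: n => [|n [dh IH]].
  split => [j y|y]; last by rewrite big_ord1 bin0 mul1r subnn Q1.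
  rewrite leqn0 => /eqP ->.
  have -> : derive1n 0 h = Q 1%N * (fun y => (Q 0%N y)^-1).
    by apply/funext => z; rewrite /= fctE Q1 mulfK.
  by apply: derivableM; [|apply: derivableV].
have IH' y : Q n.+2 y =
    \sum_(j < n.+2) 'C(n.+1, j)%:R * derive1n j h y * Q (n.+1 - j)%N y.
  rewrite (leibniz_pascal (fun j => derive1n j h y) (Q^~ y)).
  have dS : is_derive y 1
      (\sum_(j < n.+1) ('C(n, j)%:R \*: (derive1n j h * Q (n - j)%N)))
      (\sum_(j < n.+1) 'C(n, j)%:R *:
         (derive1n j h y *: Q (n.+1 - j)%N y + Q (n - j)%N y *: derive1n j.+1 h y)).
    apply: is_derive_sum => j; apply: is_deriveZ; apply: is_deriveM.
      by rewrite derive1nS derive1E; apply: derivableP; apply: dh; rewrite -ltnS.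
    by rewrite subSn // -ltnS.
  have EQ : Q n.+1 = \sum_(j < n.+1) ('C(n, j)%:R \*: (derive1n j h * Q (n - j)%N)).
    apply/funext => z; rewrite IH fct_sumE; apply: eq_bigr => j _.
    by rewrite /= -mulrA.
  have dQn := dQ n.+1 y; rewrite EQ in dQn.
  rewrite -(@derive_val _ _ _ _ _ _ _ dQn) (@derive_val _ _ _ _ _ _ _ dS).
  apply: eq_bigr => j _; rewrite /GRing.scale /=; ring.
split => // j y; rewrite leq_eqVlt => /predU1P[->|/dh//].
(* The new identity is solved for its last term, which has coefficient 1 and factor [Q 0]; this
   writes the next derivative of [h] through functions already known to be derivable. *)
pose S := \sum_(j < n.+1) ('C(n.+1, j)%:R \*: (derive1n j h * Q (n.+1 - j)%N)).
have -> : derive1n n.+1 h = (Q n.+2 - S) * (fun y => (Q 0%N y)^-1).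
  apply/funext => z; rewrite -[RHS]/((Q n.+2 z - S z) / Q 0%N z).
  rewrite IH' big_ord_recr binn mul1r subnn.
  have -> : S z = \sum_(j < n.+1) 'C(n.+1, j)%:R * derive1n j h z * Q (n.+1 - j)%N z.
    by rewrite /S fct_sumE; apply: eq_bigr => k _; rewrite -mulrA.
  by rewrite addrAC subrr add0r mulfK.
apply: derivableM; last by apply: derivableV.
apply: derivableB; first by [].
apply: derivable_sum => k; apply: derivableZ; apply: derivableM => //.
by apply: dh; rewrite -ltnS.
Qed.

(** With indices shifted, [kappa n] is the cumulant of order [n + 1]. Isolating the term [j = n] and
    dropping [j = n - 1], where [q 1 = 0], gives a recurrence for [kappa]. The triangle inequality
    makes it that of [log_coef], and each term scales as [b ^+ n.+1]. *)
Lemma log_coef_bound (R : realFieldType) r (q kappa : nat -> R) (b : R) :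
  q 0%N = 1 -> q 1%N = 0 -> 0 <= b ->
  (forall k, (k <= r)%N -> `|q k| <= b ^+ k) ->
  (forall n, (n < r)%N ->
     q n.+1 = \sum_(j < n.+1) 'C(n, j)%:R * kappa j * q (n - j)%N) ->
  forall n, (n < r)%N -> `|kappa n| <= log_coef R r n.+1 * b ^+ n.+1.
Proof.
move=> q0 q1 b0 qb qE n; elim/ltn_ind: n => n IH nr.
have kE : kappa n = (0 < n)%N%:R * q n.+1 -
    \sum_(j < n.+1 | (2 <= n - j)%N) 'C(n, j)%:R * kappa j * q (n - j)%N.
  have := qE n nr; rewrite (bigID (fun j : 'I_n.+1 => (2 <= n - j)%N)) /=.
  set S := \sum_(j < n.+1 | _) _.
  have -> : \sum_(i < n.+1 | ~~ (1 < n - i)%N)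
      'C(n, i)%:R * kappa i * q (n - i)%N = kappa n.
    rewrite (bigD1 ord_max) /= ?subnn // binn q0 mul1r mulr1 big1 ?addr0 //.
    move=> [j /= jn] /andP[]; rewrite -val_eqE /= -leqNgt => j1 jNn.
    have -> : (n - j = 1)%N.
      by apply/eqP; rewrite eqn_leq j1 subn_gt0 ltn_neqAle jNn -ltnS.
    by rewrite q1 mulr0.
  case: (n) nr => [|m] mr /= qS; last by rewrite qS mul1r addrAC subrr add0r.
  by rewrite mul0r sub0r; apply/eqP; rewrite -addr_eq0 addrC -qS q1.
rewrite kE log_coef_rec // mulrDl mulr_suml.
apply: le_trans (ler_normB _ _) _; apply: lerD.
  case: (n) nr => [|m] mr; first by rewrite !mul0r normr0.
  by rewrite !mul1r qb.
apply: le_trans (ler_norm_sum _ _ _) _; apply: ler_sum => -[j /= jn] nj.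
rewrite ltnS in jn.
have jn' : (j < n)%N by rewrite -subn_gt0 (leq_trans _ nj).
have -> : b ^+ n.+1 = b ^+ j.+1 * b ^+ (n - j) by rewrite -exprD addSn subnKC.
apply: le_trans (_ : 'C(n, j)%:R *
  ((log_coef R r j.+1 * b ^+ j.+1) * b ^+ (n - j)) <= _); last by rewrite !mulrA.
rewrite !normrM normr_nat -mulrA ler_wpM2l // ler_pM ?normr_ge0 //.
  exact: IH jn' (ltn_trans jn' nr).
by rewrite qb // (leq_trans (leq_subr _ _)) // ltnW.
Qed.

(** The tangent at 1 to the concave function [x^(k/r)], taken at [x = u^r] and cleared of
    denominators. It gives Lyapunov's inequality without roots. *)
Lemma lyapunov_tangent (R : realFieldType) (u : R) k r :
  0 <= u -> (k <= r)%N -> r%:R * u ^+ k <= (r - k)%:R + k%:R * u ^+ r.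
Proof.
move=> u0; elim: r => [|r IH].
  by rewrite leqn0 => /eqP ->; rewrite !mul0r subnn.
rewrite leq_eqVlt => /predU1P[->|]; first by rewrite subnn add0r.
rewrite ltnS => kr; rewrite subSn // -natr1 mulrDl mul1r -natr1 .
apply: le_trans (_ : (r - k)%:R + k%:R * u ^+ r + u ^+ k <= _).
  by rewrite lerD2r IH.
(* Both sides of the reduced inequality carry the factor [1 - u]. For [i < k <= r] the difference
   [u^i - u^r] has the sign of [1 - u], so the [k] terms compare one by one. *)
have H : k%:R * (u ^+ r - u^+ r.+1) + u ^+ k <= 1.
  suff : k%:R * (u ^+ r - u^+ r.+1) <= 1 - u ^+ k by lra.
  have -> : u ^+ r - u ^+ r.+1 = u ^+ r * (1 - u) by rewrite exprS; ring.
  have -> : 1 - u ^+ k = (\sum_(i < k) u ^+ i) * (1 - u).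
    have := subrX1 u k; rewrite -(opprB (u ^+ k)) => ->; ring.
  rewrite mulrA -[k in k%:R]card_ord -sum1_card natr_sum mulr_suml !mulr_suml.
  apply: ler_sum => -[i /= ik] _; rewrite mul1r.
  have [u1|u1] := leP u 1.
    by rewrite ler_wpM2r ?subr_ge0 // ler_wiXn2l // (leq_trans (ltnW ik)).
  rewrite ler_wnM2r ?subr_le0 ?(ltW u1) //.
  by rewrite ler_weXn2l ?(ltW u1) ?(leq_trans (ltnW ik)).
lra.
Qed.

(** * Exponentially tilted moments *)

Lemma exprn_le_expR (R : realType) (z : R) k : 0 <= z ->
  z ^+ k <= k`!%:R * expR z.
Proof.
move=> z0; case: k => [|k]; first by rewrite expr0 fact0 mul1r -[leLHS]expR0 ler_expR.
have := expR_ge1Dxn k z0 => H.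
rewrite mulrC -ler_pdivrMr; last by rewrite ltr0n fact_gt0.
by apply: le_trans H; rewrite lerDr.
Qed.

Section tilted_moments.
Context d (T : measurableType d) (R : realType).
Variables (mu : {measure set T -> \bar R}) (Z W : T -> R).
Hypotheses (mZ : measurable_fun setT Z) (mW : measurable_fun setT W).
Hypothesis W0 : forall x, 0 <= W x.
Hypothesis exp_int : forall b : R,
  mu.-integrable setT (EFin \o (fun x => expR (b * `|Z x|) * W x)).

(** Measure and weight are left general to serve twice: for [X - a] under [P] with weight
    [exp (- X^2 / 2)], and for the identity under Lebesgue measure with the Gaussian density. *)
Definition tilted (k : nat) (y : R) (x : T) : R := Z x ^+ k * expR (Z x * y) * W x.

Definition tilted_moment (k : nat) (y : R) : R := Rintegral mu setT (tilted k y).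

Lemma measurable_tilted k y : measurable_fun setT (tilted k y).
Proof.
apply: measurable_funM => //; apply: measurable_funM.
  exact: measurable_funX.
by apply: measurableT_comp => //; apply: measurable_funM.
Qed.

(** The extra 1 in [b + 1] absorbs the power, by [|Z|^k <= k! exp |Z|]. The bound is uniform in
    [|y| <= b], as domination under the integral sign requires. *)
Lemma tilted_bound k (y b : R) x : `|y| <= b ->
  `|tilted k y x| <= k`!%:R * (expR ((b + 1) * `|Z x|) * W x).
Proof.
move=> yb; rewrite /tilted !normrM (ger0_norm (W0 x)) (ger0_norm (expR_ge0 _)).
rewrite mulrA ler_wpM2r // normrX mulrDl mul1r addrC expRD mulrA ler_pM //.
- exact: exprn_le_expR.
rewrite ler_expR (le_trans (ler_norm _)) // normrM mulrC ler_wpM2r //.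
Qed.

Lemma integrable_exp_bound k b :
  mu.-integrable setT (EFin \o (fun x => k`!%:R * (expR (b * `|Z x|) * W x))).
Proof.
have := integrableZl measurableT k`!%:R (exp_int b).
by apply: eq_integrable => // x _; rewrite /= EFinM.
Qed.

Lemma integrable_tilted k y : mu.-integrable setT (EFin \o tilted k y).
Proof.
apply: le_integrable (integrable_exp_bound k (`|y| + 1)) => //.
  exact/measurable_EFinP/measurable_tilted.
move=> x _; rewrite lee_fin; apply: le_trans (tilted_bound k x (lexx `|y|)) _.
exact: ler_norm.
Qed.

Lemma is_derive_tilted k (y : R) x :
  is_derive y 1 (fun y => tilted k y x) (tilted k.+1 y x).
Proof.
rewrite /tilted.
have -> : (fun y0 => Z x ^+ k * expR (Z x * y0) * W x) =
    (Z x ^+ k * W x) \*: (expR \o (Z x \*: id)).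
  by apply/funext => z /=; rewrite /GRing.scale /=; ring.
apply: is_derive_eq.
by rewrite /GRing.scale /= exprS; ring.
Qed.

Lemma is_derive_tilted_moment k (y : R) :
  is_derive y 1 (tilted_moment k) (tilted_moment k.+1 y).
Proof.
(* On the unit interval around [y] the parameter is bounded by [|y| + 1]; the second 1 comes from
   [tilted_bound]. *)
pose G x : R := k.+1`!%:R * (expR ((`|y| + 1 + 1) * `|Z x|) * W x).
have yI : `]y - 1, y + 1[%classic y.
  by rewrite /= in_itv /=; apply/andP; split; lra.
have dT z x : derivable (tilted k ^~ x) z 1 by have := is_derive_tilted k z x; case.
have dTE : (partial1of2 (tilted k)) = tilted k.+1.
  apply/funext => z; apply/funext => x; rewrite partial1of2E.
  exact: (@derive_val _ _ _ _ _ _ _ (is_derive_tilted k z x)).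
have Iint z : mu.-integrable setT (EFin \o tilted k z) by exact: integrable_tilted.
have G0 x : 0 <= G x by rewrite mulr_ge0 // mulr_ge0 // expR_ge0.
have GB z x : `]y - 1, y + 1[%classic z -> setT x ->
    `|partial1of2 (tilted k) z x| <= G x.
  rewrite dTE => /= zI _; apply: tilted_bound.
  rewrite (_ : z = y + (z - y)); last by rewrite addrC subrK.
  rewrite (le_trans (ler_normD _ _)) // lerD2l ler_norml.
  by move: zI; rewrite in_itv /= => /andP[]; lra.
have iG : mu.-integrable setT (EFin \o G) by exact: integrable_exp_bound.
apply: DeriveDef.
  exact: (@derivable_under_integral _ _ _ mu _ _ measurableT _ _ _ yI
    (fun z _ => Iint z) (fun z x _ _ => dT z x) _ G0 iG GB).
rewrite -derive1E (@differentiation_under_integral _ _ _ mu _ _ measurableT _ _ _ yI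
    (fun z _ => Iint z) (fun z x _ _ => dT z x) _ G0 iG GB).
by rewrite dTE.
Qed.

End tilted_moments.

(** Convexity of the power: add the tangent inequalities at the midpoint [t] for [u] and for [v].
    The case [u = v = 0] is separate because the tangent is scaled by [1 / t]. *)
Lemma mean_power_le (R : realFieldType) (u v : R) m : 0 <= u -> 0 <= v ->
  (u + v) ^+ m.+1 <= 2 ^+ m * (u ^+ m.+1 + v ^+ m.+1).
Proof.
move=> u0 v0; have [s0|s0] := leP (u + v) 0.
  have -> : u = 0 by lra.
  have -> : v = 0 by lra.
  by rewrite addr0 expr0n addr0 mulr0.
have [t t0 tE] : exists2 t, 0 < t & u + v = 2 * t.
  by exists ((u + v) / 2); [lra|field].
have tangent (x : R) : 0 <= x -> m.+1%:R * x * t ^+ m <= m%:R * t ^+ m.+1 + x ^+ m.+1.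
  move=> x0; have := @lyapunov_tangent _ (x / t) 1 m.+1 (divr_ge0 x0 (ltW t0)) isT.
  rewrite expr1 mul1r subSS subn0 => /(ler_wpM2r (exprn_ge0 m.+1 (ltW t0))).
  rewrite mulrDl expr_div_n divfK ?expf_neq0 ?gt_eqF // => /(le_trans _); apply.
  by rewrite le_eqVlt exprS; apply/orP; left; apply/eqP; field; rewrite gt_eqF.
have := lerD (tangent u u0) (tangent v v0).
have -> : m.+1%:R * u * t ^+ m + m.+1%:R * v * t ^+ m = m.+1%:R * (2 * t ^+ m.+1).
  by rewrite -mulrDl -mulrDr tE exprS; ring.
have -> : (u + v) ^+ m.+1 = 2 ^+ m * (2 * t ^+ m.+1).
  by rewrite tE exprMn [2 ^+ m.+1]exprS; ring.
rewrite ler_pM2l ?exprn_gt0 // -natr1.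
by lra.
Qed.

Section weighted_moments.
Context d (T : measurableType d) (R : realType).
Variables (mu : {measure set T -> \bar R}) (Z W : T -> R).

(** Integrate [lyapunov_tangent] at [u = |Z| / b] against [W]. The form is homogeneous in [W], so no
    normalisation enters, and [m] even allows [|Z|^m = Z^m]. *)
Lemma weighted_lyapunov (k m : nat) (b : R) : (0 < m)%N -> (k <= m)%N -> 0 < b ->
  (forall x, 0 <= W x) ->
  (forall j, mu.-integrable setT (EFin \o (fun x => Z x ^+ j * W x))) ->
  ~~ odd m ->
  Rintegral mu setT (fun x => Z x ^+ m * W x) <= b ^+ m * Rintegral mu setT W ->
  `|Rintegral mu setT (fun x => Z x ^+ k * W x)| <= b ^+ k * Rintegral mu setT W.
Proof.
move=> m0 km b0 W0 iZ em Hm.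
have iW : mu.-integrable setT (EFin \o W).
  by apply: eq_integrable (iZ 0%N) => // x _; rewrite /= expr0 mul1r.
apply: le_trans (le_normr_Rintegral measurableT (iZ k)) _.
have iN : mu.-integrable setT (EFin \o (fun x => `|Z x ^+ k * W x|)).
  exact: (integrable_norm (iZ k)).
have m0R : 0 < m%:R :> R by rewrite ltr0n.
rewrite -(ler_pM2l m0R) -(RintegralZl m%:R measurableT iN).
have bk0 : 0 < b ^+ k by rewrite exprn_gt0.
have bm0 : 0 < b ^+ m by rewrite exprn_gt0.
(* These are the tangent's coefficients after scaling by [b^k]; under the hypothesis on the [m]-th
   moment the two contributions add up to [m b^k] times the mass of [W]. *)
pose c1 : R := (m - k)%:R * b ^+ k.
pose c2 : R := k%:R * b ^+ k / b ^+ m.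
have ic1 : mu.-integrable setT (EFin \o (fun x => c1 * W x)).
  have := integrableZl measurableT c1 iW.
  by apply: eq_integrable => // x _; rewrite /= EFinM.
have ic2 : mu.-integrable setT (EFin \o (fun x => c2 * (Z x ^+ m * W x))).
  have := integrableZl measurableT c2 (iZ m).
  by apply: eq_integrable => // x _; rewrite /= EFinM.
apply: le_trans (_ : Rintegral mu setT (fun x => c1 * W x + c2 * (Z x ^+ m * W x)) <= _).
  apply: le_Rintegral => //.
  - have := integrableZl measurableT m%:R iN.
    by apply: eq_integrable => // x _; rewrite /= EFinM.
  - have := integrableD measurableT ic1 ic2.
    by apply: eq_integrable => // x _; rewrite /= EFinD.
  move=> x _; rewrite normrM (ger0_norm (W0 x)) !mulrA -mulrDl ler_wpM2r //.
  have := lyapunov_tangent (divr_ge0 (normr_ge0 (Z x)) (ltW b0)) km.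
  move=> /(ler_wpM2r (ltW bk0)); rewrite !expr_div_n -mulrA divfK ?gt_eqF //.
  rewrite normrX => /le_trans; apply; rewrite mulrDl lerD2l.
  rewrite -(normrX m) (ger0_norm (exprn_even_ge0 _ em)) /c2.
  by rewrite le_eqVlt; apply/orP; left; apply/eqP; ring.
rewrite RintegralD // !RintegralZl // /c1 /c2.
apply: le_trans (_ : (m - k)%:R * b ^+ k * Rintegral mu setT W +
   k%:R * b ^+ k / b ^+ m * (b ^+ m * Rintegral mu setT W) <= _).
  by rewrite lerD2l ler_wpM2l // divr_ge0 ?mulr_ge0 // ltW.
rewrite mulrA divfK ?gt_eqF // -mulrDl -mulrDl -natrD subnK //.
by rewrite mulrA.
Qed.
End weighted_moments.

(** * Pointwise bound on the derivatives of the conditional mean *)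

(** A zero integral would force [f = 0] almost everywhere and make the whole space negligible. *)
Lemma probability_Rintegral_gt0 d (T : measurableType d) (R : realType)
  (P : probability T R) (f : T -> R) :
  P.-integrable setT (EFin \o f) -> (forall x, 0 < f x) -> 0 < Rintegral P setT f.
Proof.
move=> fi f0; rewrite lt_neqAle Rintegral_ge0 ?andbT => [|x _]; last exact: ltW.
apply/eqP => If.
have mf := measurable_int P fi.
have I0 : (\int[P]_x `|(EFin \o f) x| = 0)%E.
  under eq_integral do rewrite /= ger0_norm ?ltW //.
  have := integrable_fin_num measurableT fi.
  by move/fineK => <-; rewrite -/(Rintegral P setT f) -If.
have [H _] := ae_eq_integral_abs P measurableT mf.
have {H}ae0 := H I0.
have [N [mN N0 sN]] := ae0.
have : (P setT <= P N)%E.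
  apply: le_measure; rewrite ?inE //; move=> x _; apply: sN => /= fx0.
  by have [fx] := fx0 Logic.I; have := f0 x; rewrite fx ltxx.
by rewrite N0 probability_setT lee_fin ler10.
Qed.

Section gaussian_weight.
Context d (T : measurableType d) (R : realType).
Variables (P : probability T R) (X : T -> R).
Hypothesis mX : measurable_fun setT X.

Definition gweight (y : R) (w : T) : R := expR (- (X w - y) ^+ 2 / 2).

(** The centre [a] stays free: it will be the conditional mean at [y] for the cumulant bound, and 0
    or [y] when integrating. *)
Definition gmoment (a : R) (k : nat) (y : R) : R :=
  Rintegral P setT (fun w => (X w - a) ^+ k * gweight y w).

Let W w : R := expR (- (X w) ^+ 2 / 2).
Let Z a w : R := X w - a.

Let mZ a : measurable_fun setT (Z a).
Proof. exact: measurable_funB. Qed.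

Let mW : measurable_fun setT W.
Proof.
apply: measurableT_comp => //; apply: measurable_funM => //.
by apply: measurableT_comp => //; exact: measurable_funX.
Qed.

Let W0 w : 0 <= W w. Proof. exact: expR_ge0. Qed.

Let exp_int a b : P.-integrable setT (EFin \o (fun w => expR (b * `|Z a w|) * W w)).
Proof.
apply: (@le_integrable _ _ _ P setT measurableT _
  (EFin \o cst (expR (`|b| * `|a| + b ^+ 2 / 2)))).
- apply/measurable_EFinP; apply: measurable_funM => //.
  apply: measurableT_comp => //; apply: measurable_funM => //.
  by apply: measurableT_comp => //; exact: mZ.
- move=> w _; rewrite lee_fin /= [leLHS]ger0_norm ?mulr_ge0 ?expR_ge0 //.
  rewrite [leRHS]ger0_norm ?expR_ge0 //.
  rewrite /W -expRD ler_expR.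
  have h1 : b * `|Z a w| <= `|b| * (`|X w| + `|a|).
    apply: le_trans (_ : `|b| * `|Z a w| <= _).
      by rewrite ler_wpM2r // ler_norm.
    by rewrite ler_wpM2l // ler_normB.
  have h2 : (X w) ^+ 2 = `|X w| ^+ 2 by rewrite real_normK ?num_real.
  have h3 : b ^+ 2 = `|b| ^+ 2 by rewrite real_normK ?num_real.
  (* This square yields [|b| |X| <= (b^2 + X^2) / 2], so the weight absorbs the exponential and
     leaves a constant. *)
  have h4 : 0 <= (`|b| - `|X w|) ^+ 2 by exact: sqr_ge0.
  rewrite h2 h3; move: h4 h1; rewrite sqrrB. lra.
- exact: finite_measure_integrable_cst.
Qed.

Let tilt a y : R := expR (a * y - y ^+ 2 / 2).

(** Expanding the square shows that [y] acts as an exponential tilt, up to a factor constant in [w]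
    that cancels in quotients of moments. *)
Let gweight_tilted a k y w :
  (X w - a) ^+ k * gweight y w = tilt a y * tilted (Z a) W k y w.
Proof.
rewrite /tilted.
have -> : gweight y w = tilt a y * (expR (Z a w * y) * W w).
  by rewrite /gweight /tilt /W -!expRD; congr expR; rewrite /Z; field.
by rewrite /Z; ring.
Qed.

Lemma integrable_gmoment a k y :
  P.-integrable setT (EFin \o (fun w => (X w - a) ^+ k * gweight y w)).
Proof.
have := integrableZl measurableT (tilt a y)
  (integrable_tilted (mZ a) mW W0 (exp_int a) k y).
by apply: eq_integrable => // w _; rewrite /= gweight_tilted EFinM.
Qed.

Let gmomentE a k y : gmoment a k y = tilt a y * tilted_moment P (Z a) W k y.
Proof.
rewrite /gmoment /tilted_moment -RintegralZl //.
  by apply: eq_Rintegral => w _; exact: gweight_tilted.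
exact: (integrable_tilted (mZ a) mW W0 (exp_int a) k y).
Qed.

Lemma gmoment0_gt0 a y : 0 < gmoment a 0 y.
Proof.
apply: probability_Rintegral_gt0; first exact: integrable_gmoment.
by move=> w; rewrite expr0 mul1r expR_gt0.
Qed.

Lemma gmoment0E a b y : gmoment a 0 y = gmoment b 0 y.
Proof. by apply: eq_Rintegral => w _; rewrite !expr0. Qed.

Lemma smoothfE a y : smoothf P X y = a + gmoment a 1 y / gmoment a 0 y.
Proof.
have H0 := gmoment0_gt0 a y; apply/eqP; rewrite -subr_eq0; apply/eqP.
have iE0 : P.-integrable setT (EFin \o gweight y).
  apply: eq_integrable (integrable_gmoment a 0 y) => // w _.
  by rewrite /= expr0 mul1r.
have E0 : gmoment a 0 y = Rintegral P setT (gweight y).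
  by apply: eq_Rintegral => w _; rewrite expr0 mul1r.
have E1 : gmoment 0 1 y = a * gmoment a 0 y + gmoment a 1 y.
  rewrite E0 -RintegralZl // -RintegralD //.
  - by apply: eq_Rintegral => w _; rewrite !expr1 /gweight; ring.
  - have := integrableZl measurableT a iE0.
    by apply: eq_integrable => // w _; rewrite /= EFinM.
  - exact: integrable_gmoment.
have -> : smoothf P X y = gmoment 0 1 y / gmoment a 0 y.
  rewrite E0 /smoothf; congr (_ / _).
  by apply: eq_Rintegral => w _; rewrite expr1 subr0.
by rewrite E1; field; rewrite gt_eqF.
Qed.

Let Q a := tilted_moment P (Z a) W.

Let Q0_neq0 a y : Q a 0%N y != 0.
Proof.
have := gmoment0_gt0 a y; rewrite gmomentE => H; apply/eqP => Q0.
by move: H; rewrite -/(Q a 0%N y) Q0 mulr0 ltxx.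
Qed.

Let smoothf_leibniz a n :
  (forall y, derivable (derive1n n (fun y => smoothf P X y - a)) y 1) /\
    (forall y, Q a n.+1 y =
       \sum_(j < n.+1) 'C(n, j)%:R * derive1n j (fun y => smoothf P X y - a) y
          * Q a (n - j)%N y).
Proof.
apply: leibniz_quotient => [k y|y|y]; first 1 last.
- exact: Q0_neq0.
- rewrite (smoothfE a) !gmomentE -!/(Q _ _ _).
  have := Q0_neq0 a y; have := expR_gt0 (a * y - y ^+ 2 / 2).
  by rewrite /tilt => t0 q0; field; rewrite q0 gt_eqF.
exact: is_derive_tilted_moment.
Qed.

Lemma derivable_smoothf n y : derivable (derive1n n (smoothf P X)) y 1.
Proof.
have [/(_ y) + _] := smoothf_leibniz 0 n.
by under eq_fun do rewrite subr0.
Qed.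

(** Shift invariance of the cumulants of order at least 2; it lets the centre depend on the point
    under study. *)
Lemma derive1n_smoothf_subr a n :
  derive1n n.+1 (fun y => smoothf P X y - a) = derive1n n.+1 (smoothf P X).
Proof.
rewrite /derive1n !iterSr; congr (iter _ _ _); apply/funext => y.
rewrite !derive1E; apply: derive_val.
have dS : is_derive y 1 (derive1n 0 (smoothf P X)) ('D_1 (smoothf P X) y).
  by apply: derivableP; exact: derivable_smoothf.
rewrite -['D_1 (smoothf P X) y]subr0; exact: is_deriveB.
Qed.

Lemma gmoment_rec a n y : gmoment a n.+1 y =
  \sum_(j < n.+1) 'C(n, j)%:R * derive1n j (fun y => smoothf P X y - a) y
     * gmoment a (n - j)%N y.
Proof.
have [_ /(_ y) QE] := smoothf_leibniz a n.
rewrite gmomentE -/(Q a) QE mulr_sumr; apply: eq_bigr => j _.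
by rewrite gmomentE -/(Q a); ring.
Qed.

(** Lyapunov gives [|c - a| <= b], hence [|X - c| <= |X - a| + b], and [mean_power_le] bounds the
    power of this sum. Recentring at the conditional mean thus doubles [b], which is the source of
    [2 ^ r]. *)
Lemma gmoment_center_le a c m (b : R) y : 0 < b -> c = smoothf P X y ->
  gmoment a m.*2.+2 y <= b ^+ m.*2.+2 * gmoment a 0 y ->
  gmoment c m.*2.+2 y <= (2 * b) ^+ m.*2.+2 * gmoment a 0 y.
Proof.
set M := m.*2.+2 => b0 cE Hb.
have eM : ~~ odd M by rewrite /= odd_double.
have G0 := gmoment0_gt0 a y.
have gE : gmoment a 0 y = Rintegral P setT (gweight y).
  by apply: eq_Rintegral => w _; rewrite expr0 mul1r.
have := @weighted_lyapunov _ _ _ P (fun w => X w - a) (gweight y) 1 M b isT isT b0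
  (fun w => expR_ge0 _) (fun j => integrable_gmoment a j y) eM.
rewrite -gE -/(gmoment a 1 y) => /(_ Hb); rewrite expr1 => H1.
have ca : `|c - a| <= b.
  rewrite cE (smoothfE a) [a + _]addrC addrK normrM normfV (gtr0_norm G0).
  by rewrite ler_pdivrMr.
have iE0 : P.-integrable setT (EFin \o gweight y).
  apply: eq_integrable (integrable_gmoment a 0 y) => // w _.
  by rewrite /= expr0 mul1r.
have i1 : P.-integrable setT (EFin \o (fun w => b ^+ M * gweight y w)).
  have := integrableZl measurableT (b ^+ M) iE0.
  by apply: eq_integrable => // w _; rewrite /= EFinM.
have i2 : P.-integrable setT
    (EFin \o (fun w => (X w - a) ^+ M * gweight y w + b ^+ M * gweight y w)).
  have := integrableD measurableT (integrable_gmoment a M y) i1.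
  by apply: eq_integrable => // w _; rewrite /= EFinD.
apply: le_trans (_ : 2 ^+ M.-1 * (gmoment a M y + b ^+ M * gmoment a 0 y) <= _).
  rewrite gE -RintegralZl // -RintegralD //; last exact: integrable_gmoment.
  rewrite -RintegralZl //; apply: le_Rintegral => //.
  - exact: integrable_gmoment.
  - have := integrableZl measurableT (2 ^+ M.-1) i2.
    by apply: eq_integrable => // w _; rewrite /= EFinM.
  move=> w _; rewrite -mulrDl mulrA ler_wpM2r ?expR_ge0 //.
  rewrite -(ger0_norm (exprn_even_ge0 (X w - c) eM)) normrX.
  rewrite -[in leRHS](ger0_norm (exprn_even_ge0 (X w - a) eM)) normrX.
  apply: le_trans (mean_power_le _ _ (ltW b0)) => //.
  rewrite lerXn2r ?nnegrE ?addr_ge0 ?(ltW b0) //.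
  have -> : X w - c = (X w - a) - (c - a) by ring.
  by apply: le_trans (ler_normB _ _) _; rewrite lerD2l.
have -> : (2 * b) ^+ M = 2 ^+ M.-1 * (2 * b ^+ M).
  by rewrite exprMn /M [2 ^+ m.*2.+2]exprS /=; ring.
by rewrite -mulrA ler_pM2l ?exprn_gt0 //; lra.
Qed.

(** Centred at [c = f(y)] the first moment vanishes and the normalised moments of order up to [r]
    are at most [(2b)^k], so [log_coef_bound] applies with the derivatives of [f - c] as
    cumulants. *)
Lemma derive1n_smoothf_le a r (b : R) y : (2 <= r)%N -> 0 < b ->
  gmoment a (2 * r) y <= b ^+ (2 * r) * gmoment a 0 y ->
  `|derive1n r.-1 (smoothf P X) y| <= C_const R r * (2 * b) ^+ r.
Proof.
move=> r2 b0 Hb; have r0 : (0 < r)%N by rewrite (leq_trans _ r2).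
pose c := smoothf P X y.
have rE : (2 * r = r.-1.*2.+2)%N by rewrite mul2n -{1}(prednK r0) doubleS.
have b20 : 0 < 2 * b by rewrite mulr_gt0.
have Hc : gmoment c (2 * r) y <= (2 * b) ^+ (2 * r) * gmoment c 0 y.
  by rewrite rE (gmoment0E c a); apply: gmoment_center_le => //; rewrite -rE.
have G0 := gmoment0_gt0 c y.
have gE : gmoment c 0 y = Rintegral P setT (gweight y).
  by apply: eq_Rintegral => w _; rewrite expr0 mul1r.
pose q k := gmoment c k y / gmoment c 0 y.
pose kappa j := derive1n j (fun y => smoothf P X y - c) y.
have -> : derive1n r.-1 (smoothf P X) y = kappa r.-1.
  by rewrite /kappa -(prednK (_ : 0 < r.-1)%N) ?derive1n_smoothf_subr // -subn1 subn_gt0.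
rewrite C_constE // -/(log_coef R r r) -{3 4}(prednK r0).
apply: (@log_coef_bound _ r q) => //.
- by rewrite /q divff // gt_eqF.
- have := gmoment_rec c 0 y; rewrite /q => ->.
  by rewrite big_ord1 /= /c subrr mulr0 mul0r mul0r.
- exact: ltW.
- move=> k kr; rewrite /q normrM normfV (gtr0_norm G0) ler_pdivrMr // gE.
  apply: (@weighted_lyapunov _ _ _ P (fun w => X w - c) (gweight y) k (2 * r)) => //.
  + by rewrite muln_gt0.
  + by rewrite (leq_trans kr) // leq_pmull.
  + by move=> w; exact: expR_ge0.
  + by move=> j; exact: integrable_gmoment.
  + by rewrite mul2n odd_double.
  + by rewrite -gE.
- move=> n _; rewrite /q gmoment_rec mulr_suml; apply: eq_bigr => j _.
  by rewrite mulrA.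
by rewrite prednK.
Qed.

(** Squaring and clearing the denominator makes both sides integrable over [y] against the same
    Gaussian kernel. *)
Lemma derive1n_smoothf_sqr_le a r y : (2 <= r)%N ->
  (derive1n r.-1 (smoothf P X) y) ^+ 2 * gmoment a 0 y <=
  (2 ^+ r * C_const R r) ^+ 2 * gmoment a (2 * r) y.
Proof.
move=> r2; have r0 : (0 < r)%N by rewrite (leq_trans _ r2).
have G0 := gmoment0_gt0 a y; have G0' := ltW G0.
rewrite -ler_pdivlMr // -mulrA; apply/ler_addgt0Pr => e e0.
pose K : R := (2 ^+ r * C_const R r) ^+ 2.
have K0 : 0 <= K by exact: sqr_ge0.
pose s := gmoment a (2 * r) y / gmoment a 0 y.
have s0 : 0 <= s.
  apply: divr_ge0 => //; apply: Rintegral_ge0 => w _.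
  by rewrite mulr_ge0 ?expR_ge0 // mulnC exprM sqr_ge0.
(* The natural choice is [b^(2r) = s], but [s] may vanish while [b] must be positive. The increment
   costs [K e / (K + 1) <= e], with [K + 1] nonzero even if [K = 0]. *)
pose t := s + e / (K + 1).
have t0 : 0 < t by rewrite ltr_wpDl // divr_gt0 // ltr_wpDl.
pose b := t `^ (2 * r)%:R^-1.
have b0 : 0 < b by rewrite powR_gt0.
have bt : b ^+ (2 * r) = t.
  rewrite /b -powR_mulrn ?powR_ge0 // -powRrM mulVf ?powRr1 ?ltW //.
  by rewrite pnatr_eq0 muln_eq0 -!lt0n.
have := @derive1n_smoothf_le a r b y r2 b0; rewrite bt => H.
have {}H : `|derive1n r.-1 (smoothf P X) y| <= C_const R r * (2 * b) ^+ r.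
  apply: H; rewrite -ler_pdivrMr // -/s lerDl; apply: divr_ge0; first exact: ltW.
  by rewrite addr_ge0.
rewrite -real_normK ?num_real //.
apply: le_trans (_ : (C_const R r * (2 * b) ^+ r) ^+ 2 <= _).
  by rewrite lerXn2r ?nnegrE // (le_trans _ H).
have -> : (C_const R r * (2 * b) ^+ r) ^+ 2 = K * t.
  rewrite -bt /K [(2 * b) ^+ r]exprMn mulnC [b ^+ (r * 2)]exprM.
  by move: (2 ^+ r) (b ^+ r) => u v; ring.
rewrite /t mulrDr lerD2l mulrCA -[leRHS]mulr1 ler_wpM2l ?ltW //.
by rewrite ltr_pdivrMr ?mul1r ?ltrDl // ltr_wpDl.
Qed.

End gaussian_weight.

(** * The Gaussian channel *)

(** The Radon-Nikodym derivative agrees almost everywhere with the Gaussian density, since both have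
    the same integral over every measurable set. *)
Lemma ge0_integral_normal_prob (R : realType) (m s : R) (f : R -> \bar R) :
  measurable_fun setT f -> (forall x, 0 <= f x)%E ->
  (\int[normal_prob m s]_x f x =
   \int[lebesgue_measure]_x (f x * (normal_pdf m s x)%:E))%E.
Proof.
move=> mf f0.
have dom := @normal_prob_dominates R m s.
rewrite -(Radon_Nikodym_SigmaFinite.change_of_variables dom) //=.
have iRN := Radon_Nikodym_SigmaFinite.f_integrable dom.
have mpdf : measurable_fun setT (fun x => (normal_pdf m s x)%:E).
  by apply/measurable_EFinP; exact: measurable_normal_pdf.
apply: ae_eq_integral => //.
- by apply: emeasurable_funM => //; exact: (measurable_int lebesgue_measure).
- exact: emeasurable_funM.
apply: ae_eqe_mul2l; apply: integral_ae_eq => //= E _ mE.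
by rewrite -Radon_Nikodym_SigmaFinite.f_integral.
Qed.

Lemma ge0_integral_shift (R : realType) (a : R) (f : R -> R) :
  continuous f -> (forall x, 0 <= f x) ->
  (\int[lebesgue_measure]_x (f (x + a))%:E = \int[lebesgue_measure]_x (f x)%:E)%E.
Proof.
move=> cf f0.
have d1 (x : R) : is_derive x 1 (shift a : R -> R) 1 by exact: is_derive_shift.
have dE : (shift a : R -> R)^`()%classic = cst 1.
  by apply/funext => x; rewrite derive1E; apply: derive_val.
rewrite [RHS](@increasing_ge0_integration_by_substitutionT R (shift a) f) //.
- by rewrite dE; apply: eq_integral => x _; rewrite fctE /= mulr1.
- by move=> x y xy /=; rewrite ltrD2r.
- by rewrite dE => x; exact: cvg_cst.
- by rewrite dE; exact: is_cvg_cst.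
- by rewrite dE; exact: is_cvg_cst.
- exact: cvg_addrr_Ny.
- exact: cvg_addrr.
Qed.

(** The law of the pair agrees with the product measure on rectangles, hence everywhere; Tonelli
    concludes. *)
Lemma ge0_integral_indep d d1 d2 (T : measurableType d)
  (T1 : measurableType d1) (T2 : measurableType d2) (R : realType)
  (P : probability T R) (X : T -> T1) (N : T -> T2) (Q : probability T2 R)
  (f : T1 * T2 -> \bar R) :
  measurable_fun setT X -> measurable_fun setT N ->
  (forall A B, measurable A -> measurable B ->
    P (X @^-1` A `&` N @^-1` B) = (P (X @^-1` A) * Q B)%E) ->
  measurable_fun setT f -> (forall z, 0 <= f z)%E ->
  (\int[P]_w f (X w, N w) = \int[P]_w \int[Q]_n f (X w, n))%E.
Proof.
move=> mX mN XN mf f0.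
have mXN : measurable_fun setT (fun w => (X w, N w)) by exact: measurable_fun_pair.
pose X' : {mfun T >-> T1} := HB.pack X (isMeasurableFun.Build _ _ _ _ X mX).
pose XN' : {mfun T >-> (T1 * T2)%type} :=
  HB.pack (fun w => (X w, N w)) (isMeasurableFun.Build _ _ _ _ _ mXN).
pose m1 : probability T1 R := distribution P X'.
pose m12 : probability (T1 * T2)%type R := distribution P XN'.
transitivity (\int[m12]_z f z)%E.
  by rewrite ge0_integral_distribution.
transitivity (\int[(m1 \x Q)%E]_z f z)%E.
  apply: (@eq_measure_integral _ _ _ setT (m1 \x Q)%E m12 f) => A mA _.
  apply/esym; apply: product_measure_unique => // B C mB mC.
rewrite fubini_tonelli1 // ge0_integral_distribution //.
- exact: measurable_fun_fubini_tonelli_F.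
- by move=> x; apply: integral_ge0.
Qed.

Lemma normal_pdf01E (R : realType) (x : R) :
  normal_pdf 0 1 x = normal_peak 1 * expR (- x ^+ 2 / 2).
Proof. by rewrite normal_pdfE ?oner_neq0 // /normal_fun subr0 expr1n. Qed.

Lemma ge0_integral_gaussian_channel d (T : measurableType d) (R : realType)
  (P : probability T R) (X N : T -> R) (h : R -> R) :
  measurable_fun setT X -> measurable_fun setT N ->
  (forall A : set R, measurable A -> P (N @^-1` A) = normal_prob 0 1 A) ->
  indep_rv P X N -> continuous h -> (forall x, 0 <= h x) ->
  (\int[P]_w (h (X w + N w))%:E =
   \int[P]_w \int[lebesgue_measure]_y (h y * normal_pdf 0 1 (y - X w))%:E)%E.
Proof.
move=> mX mN NQ XN ch h0.
have mh : measurable_fun setT h by exact: continuous_measurable_fun.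
transitivity (\int[P]_w \int[normal_prob 0 1]_n (h (X w + n))%:E)%E.
  apply: (@ge0_integral_indep _ _ _ T (measurableTypeR R) (measurableTypeR R) R P X N
    (normal_prob 0 1) (fun z => (h (z.1 + z.2))%:E)) => //.
  - by move=> A B mA mB; rewrite XN // NQ.
  - apply/measurable_EFinP; apply: measurableT_comp => //.
    by apply: measurable_funD; [exact: measurable_fst|exact: measurable_snd].
  - by move=> z; rewrite lee_fin.
apply: eq_integral => w _.
rewrite ge0_integral_normal_prob; last 2 first.
- apply/measurable_EFinP; apply: measurableT_comp => //.
  exact: measurable_funD.
- by move=> x; rewrite lee_fin.
rewrite -[RHS](ge0_integral_shift (X w)).
- by apply: eq_integral => x _; rewrite addrK [x + _]addrC EFinM.
- move=> x; apply: (@cvgM _ _ _ _ h (fun y => normal_pdf 0 1 (y - X w))); first exact: ch.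
  apply: (@continuous_comp _ _ _ (fun y => y - X w)).
    by apply: continuousB => //; exact: cst_continuous.
  by apply: continuous_normal_pdf; exact: oner_neq0.
- by move=> x; rewrite mulr_ge0 // normal_pdf_ge0.
Qed.

(** Completing the square; it gives exponential integrability and the moment generating function. *)
Lemma expR_normal_pdf (R : realType) (b x : R) :
  expR (b * x) * normal_pdf 0 1 x = expR (b ^+ 2 / 2) * normal_pdf b 1 x.
Proof.
rewrite !normal_pdfE ?oner_neq0 // /normal_fun subr0 expr1n.
rewrite mulrCA [RHS]mulrCA -!expRD; congr (_ * expR _); by field.
Qed.

(** * Moments of the standard Gaussian *)

Section gaussian_moments.
Variable R : realType.
Let mu : {measure set (measurableTypeR R) -> \bar R} := lebesgue_measure.
Let Z : measurableTypeR R -> R := id.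
Let W : measurableTypeR R -> R := normal_pdf 0 1.

Let mZ : measurable_fun setT Z. Proof. exact: measurable_id. Qed.
Let mW : measurable_fun setT W. Proof. exact: measurable_normal_pdf. Qed.
Let W0 x : 0 <= W x. Proof. exact: normal_pdf_ge0. Qed.

Let exp_int1 (b : R) : mu.-integrable setT (EFin \o (fun x => expR (b * x) * W x)).
Proof.
have := integrableZl measurableT (expR (b ^+ 2 / 2)) (integrable_normal_pdf b 1).
by apply: eq_integrable => // x _; rewrite /= /W expR_normal_pdf EFinM.
Qed.

Let exp_int (b : R) :
  mu.-integrable setT (EFin \o (fun x => expR (b * `|Z x|) * W x)).
Proof.
apply: (le_integrable measurableT _ _
  (integrableD measurableT (exp_int1 b) (exp_int1 (- b)))).
- apply/measurable_EFinP; apply: measurable_funM => //.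
  apply: measurableT_comp => //; apply: measurable_funM => //.
  exact: measurableT_comp.
move=> x _; rewrite lee_fin.
have e0 (c : R) : 0 <= expR c * W x by rewrite mulr_ge0 // expR_ge0.
rewrite [leLHS]ger0_norm // [leRHS]ger0_norm ?addr_ge0 //; case: (leP 0 x) => x0.
  by rewrite /Z ger0_norm // lerDl.
by rewrite /Z ltr0_norm // mulrN mulNr lerDr.
Qed.

Definition gaussian_moment (k : nat) : R := tilted_moment mu Z W k 0.

Lemma gaussian_momentE k :
  (\int[lebesgue_measure]_x (x ^+ k * normal_pdf 0 1 x)%:E = (gaussian_moment k)%:E)%E.
Proof.
have ik := integrable_tilted mZ mW W0 exp_int k 0.
rewrite /gaussian_moment /tilted_moment /Rintegral fineK.
  by apply: eq_integral => x _; rewrite /tilted mulr0 expR0 mulr1.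
exact: integrable_fin_num.
Qed.

Let mgf (t : R) : tilted_moment mu Z W 0 t = expR (t ^+ 2 / 2).
Proof.
rewrite /tilted_moment /Rintegral.
under eq_integral => x _.
  rewrite /tilted expr0 mul1r mulrC [Z x * t]mulrC -/(W x) mulrC expR_normal_pdf EFinM.
  over.
rewrite integralZl //; last exact: integrable_normal_pdf.
by rewrite integral_normal_pdf mule1.
Qed.

Lemma gaussian_moment0 : gaussian_moment 0 = 1.
Proof. by rewrite /gaussian_moment mgf expr0n mul0r expR0. Qed.

(** The moment generating function satisfies [M'(t) = t M(t)], so [leibniz_quotient] applies with
    [h] the identity. At [t = 0] only the term [j = 1] survives. *)
Lemma gaussian_momentSS n : gaussian_moment n.+2 = n.+1%:R * gaussian_moment n.
Proof.
have dQ := is_derive_tilted_moment mZ mW W0 exp_int.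
have Q0 (y : R) : tilted_moment mu Z W 0 y != 0 by rewrite mgf gt_eqF // expR_gt0.
have Q1 (y : R) : tilted_moment mu Z W 1 y = y * tilted_moment mu Z W 0 y.
  rewrite -(@derive_val _ _ _ _ _ _ _ (dQ 0%N y)).
  have -> : tilted_moment mu Z W 0 = expR \o (fun t => 2^-1 * t ^+ 2).
    by apply/funext => t; rewrite mgf /= mulrC.
  have d2 : is_derive y 1 (fun t : R => 2^-1 * t ^+ 2) y.
    have -> : (fun t : R => 2^-1 * t ^+ 2) = 2^-1 \*: (id ^+ 2 : R -> R).
      by apply/funext => t.
    by apply: is_derive_eq; rewrite /GRing.scale /=; field.
  have dE := @is_derive1_comp _ expR (fun t : R => 2^-1 * t ^+ 2) y _ _ (is_derive_expR _) d2.
  by rewrite (@derive_val _ _ _ _ _ _ _ dE) mulrC.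
have [_ /(_ 0)] := leibniz_quotient dQ Q0 Q1 n.+1.
rewrite -/(gaussian_moment n.+2) => ->.
have d1 : derive1n 1 (id : R -> R) = cst 1.
  by apply/funext => y; rewrite /= derive1E derive_id.
have dn j : derive1n j.+2 (id : R -> R) = cst 0.
  elim: j => [|j IH]; rewrite derive1nS ?IH ?d1.
    by apply/funext => y; rewrite derive1_cst.
  by apply/funext => y; rewrite derive1_cst.
have idE j : derive1n j (id : R -> R) 0 = (j == 1)%:R.
  by case: j => [|[|j]] //; rewrite ?d1 ?dn.
under eq_bigr => j _ do rewrite idE.
rewrite (bigD1 (@Ordinal n.+2 1 isT)) //= bin1 mulr1 subSS subn0 big1 ?addr0 // => j.
by rewrite -val_eqE /= => /negPf ->; rewrite mulr0 mul0r.
Qed.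

(** Each step multiplies the square by [(2k + 1)^2] and the factorial by [(2k + 1)(2k + 2)]. *)
Lemma gaussian_moment_sqr_le k :
  0 <= gaussian_moment (2 * k) /\ gaussian_moment (2 * k) ^+ 2 <= ((2 * k)`!)%:R.
Proof.
elim: k => [|k [IH0 IH]].
  by rewrite muln0 gaussian_moment0 expr1n fact0.
rewrite mulnS gaussian_momentSS; split; first by rewrite mulr_ge0.
rewrite !factS exprMn !natrM mulrA ler_pM ?sqr_ge0 // expr2 ler_wpM2r // ler_nat //.
Qed.

End gaussian_moments.

Lemma integral_normal_pdf_shift (R : realType) (a : R) (h : R -> R) :
  continuous h -> (forall x, 0 <= h x) ->
  (\int[lebesgue_measure]_y (h (y - a) * normal_pdf 0 1 (y - a))%:E =
   \int[lebesgue_measure]_x (h x * normal_pdf 0 1 x)%:E)%E.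
Proof.
move=> ch h0.
rewrite -[RHS](ge0_integral_shift (- a)) // => [x|x].
  apply: (@cvgM _ _ _ _ h); first exact: ch.
  by apply: continuous_normal_pdf; exact: oner_neq0.
by rewrite mulr_ge0 // normal_pdf_ge0.
Qed.

(** * Integration of the pointwise bound over the channel *)

Section channel.
Context d (T : measurableType d) (R : realType).
Variables (P : probability T R) (X N : T -> R).
Hypothesis mX : measurable_fun setT X.
Hypothesis mN : measurable_fun setT N.
Hypothesis NQ : forall A : set R, measurable A -> P (N @^-1` A) = normal_prob 0 1 A.
Hypothesis XN : indep_rv P X N.

Let mu : {sigma_finite_measure set (measurableTypeR R) -> \bar R} := lebesgue_measure.

Lemma normal_pdf_gweight y w :
  normal_pdf 0 1 (y - X w) = normal_peak 1 * gweight X y w.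
Proof. by rewrite normal_pdf01E /gweight -sqrrN opprB. Qed.

Let fubini (g : R -> T -> R) :
  measurable_fun setT (fun z : T * measurableTypeR R => g z.2 z.1) ->
  (forall y w, 0 <= g y w) ->
  (\int[P]_w \int[lebesgue_measure]_y (g y w * normal_pdf 0 1 (y - X w))%:E =
   \int[lebesgue_measure]_y \int[P]_w (g y w * normal_pdf 0 1 (y - X w))%:E)%E.
Proof.
move=> mg g0.
apply: (@fubini_tonelli _ _ T (measurableTypeR R) R P mu
  (fun z => (g z.2 z.1 * normal_pdf 0 1 (z.2 - X z.1))%:E)).
- apply/measurable_EFinP; apply: measurable_funM => //.
  apply: (measurableT_comp (measurable_normal_pdf 0 1)).
  apply: measurable_funB; first exact: measurable_snd.
  by apply: (measurableT_comp mX); exact: measurable_fst.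
- by move=> z; rewrite lee_fin mulr_ge0 // normal_pdf_ge0.
Qed.

Let gweight_integral (c a : R) k y :
  (\int[P]_w ((c * (X w - a) ^+ k) * normal_pdf 0 1 (y - X w))%:E =
   (normal_peak 1 * (c * gmoment P X a k y))%:E)%E.
Proof.
have iG := integrable_gmoment P mX a k y.
transitivity (\int[P]_w ((normal_peak 1 * c)%:E *
    ((X w - a) ^+ k * gweight X y w)%:E))%E.
  by apply: eq_integral => w _; rewrite -EFinM normal_pdf_gweight; congr EFin; ring.
rewrite integralZl // mulrA [RHS]EFinM; congr (_ * _)%E.
by rewrite /gmoment /Rintegral fineK //; exact: integrable_fin_num.
Qed.

(** The density of [X + N] at [y] is a constant times [gmoment _ 0 y], the factor on the left of the
    pointwise bound. Tonelli brings the integral over [y] outside, where that bound applies with a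
    centre depending on [y]. *)
Lemma integral_derive1n_smoothf_sqr_le r (a : R -> R) : (2 <= r)%N ->
  measurable_fun setT a ->
  (\int[P]_w ((derive1n r.-1 (smoothf P X) (X w + N w)) ^+ 2)%:E <=
   ((2 ^+ r * C_const R r) ^+ 2)%:E *
     \int[P]_w \int[lebesgue_measure]_y
        ((X w - a y) ^+ (2 * r) * normal_pdf 0 1 (y - X w))%:E)%E.
Proof.
move=> r2 ma; set K : R := _ ^+ 2; pose k y := derive1n r.-1 (smoothf P X) y.
have K0 : 0 <= K by exact: sqr_ge0.
have ck : continuous k.
  move=> y; apply: differentiable_continuous; apply/derivable1_diffP.
  exact: derivable_smoothf.
have mk : measurable_fun setT k by exact: continuous_measurable_fun.
rewrite (ge0_integral_gaussian_channel (h := fun y => k y ^+ 2) mX mN NQ XN).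
- have e0 y w : 0 <= (X w - a y) ^+ (2 * r) by rewrite exprM exprn_ge0 // sqr_ge0.
  have me : measurable_fun setT
      (fun z : T * measurableTypeR R => (X z.1 - a z.2) ^+ (2 * r)).
    apply: measurable_funX; apply: measurable_funB.
      by apply: (measurableT_comp mX); exact: measurable_fst.
    by apply: (measurableT_comp ma); exact: measurable_snd.
  rewrite (fubini (g := fun y _ => k y ^+ 2)); last 2 first.
  + apply: measurable_funX; apply: (measurableT_comp mk); exact: measurable_snd.
  + by move=> y w; exact: sqr_ge0.
  rewrite (fubini (g := fun y w => (X w - a y) ^+ (2 * r))) //.
  have mG (g : R -> T -> R) :
      measurable_fun setT (fun z : T * measurableTypeR R => g z.2 z.1) ->
      (forall y w, 0 <= g y w) ->
      measurable_fun setT (fun y : measurableTypeR R =>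
         \int[P]_w (g y w * normal_pdf 0 1 (y - X w))%:E)%E.
    move=> mg g0.
    apply: (@measurable_fun_fubini_tonelli_G _ _ T (measurableTypeR R) R P
      (fun z => (g z.2 z.1 * normal_pdf 0 1 (z.2 - X z.1))%:E)).
    + apply/measurable_EFinP; apply: measurable_funM => //.
      apply: (measurableT_comp (measurable_normal_pdf 0 1)).
      apply: measurable_funB; first exact: measurable_snd.
      by apply: (measurableT_comp mX); exact: measurable_fst.
    + by move=> z; rewrite lee_fin mulr_ge0 // normal_pdf_ge0.
  rewrite -ge0_integralZl //; last 2 first.
  + exact: (mG _ me e0).
  + move=> y _; apply: integral_ge0 => w _.
    by rewrite lee_fin mulr_ge0 // normal_pdf_ge0.
  + apply: ge0_le_integral => //.
    * move=> y _; apply: integral_ge0 => w _.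
      by rewrite lee_fin mulr_ge0 ?sqr_ge0 // normal_pdf_ge0.
    * apply: (mG (fun y _ => k y ^+ 2)); last by move=> y w; exact: sqr_ge0.
      apply: measurable_funX; apply: (measurableT_comp mk); exact: measurable_snd.
    * by apply: measurable_funeM; exact: (mG _ me e0).
    move=> y _.
    (* A trivial power of order 0 brings the left side into the form of a moment. *)
    under eq_integral => w _ do rewrite -[k y ^+ 2]mulr1 -(expr0 (X w - a y)).
    under [in leRHS]eq_integral => w _ do rewrite -[_ ^+ (2 * r)]mul1r.
    rewrite !gweight_integral -EFinM lee_fin mul1r [leRHS]mulrCA.
    rewrite ler_wpM2l ?normal_peak_ge0 //.
    exact: derive1n_smoothf_sqr_le.
- by move=> y; apply: (@continuousM _ _ k k) => //; exact: ck.
- by move=> y; exact: sqr_ge0.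
Qed.

Lemma integral_derive1n_smoothf_sqr_le_moment r : (2 <= r)%N ->
  (\int[P]_w ((derive1n r.-1 (smoothf P X) (X w + N w)) ^+ 2)%:E <=
   ((2 ^+ r * C_const R r) ^+ 2)%:E * \int[P]_w (X w ^+ (2 * r))%:E)%E.
Proof.
move=> r2.
have m0 : measurable_fun setT (fun _ : R => 0 : R) by exact: measurable_cst.
apply: le_trans (integral_derive1n_smoothf_sqr_le r2 m0) _.
rewrite le_eqVlt; apply/orP; left; apply/eqP; congr (_ * _)%E.
apply: eq_integral => w _; rewrite subr0.
rewrite (integral_normal_pdf_shift (X w) (h := cst (X w ^+ (2 * r)))).
- under eq_integral do rewrite EFinM.
  rewrite integralZl //; last exact: integrable_normal_pdf.
  by rewrite integral_normal_pdf mule1.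
- exact: cst_continuous.
- by move=> x; rewrite /= exprM exprn_ge0 // sqr_ge0.
Qed.

(** With the centre at [y] itself, the inner integral is a Gaussian moment whatever the value of
    [X]. *)
Lemma integral_derive1n_smoothf_sqr_le_gaussian r : (2 <= r)%N ->
  (\int[P]_w ((derive1n r.-1 (smoothf P X) (X w + N w)) ^+ 2)%:E <=
   ((2 ^+ r * C_const R r) ^+ 2 * gaussian_moment R (2 * r))%:E)%E.
Proof.
move=> r2.
have mid : measurable_fun setT (fun y : R => y) by exact: measurable_id.
apply: le_trans (integral_derive1n_smoothf_sqr_le r2 mid) _.
rewrite [leRHS]EFinM le_eqVlt; apply/orP; left; apply/eqP; congr (_ * _)%E.
rewrite -[RHS]mule1 -(probability_setT P) -integral_cst //.
apply: eq_integral => w _; rewrite -gaussian_momentE /=.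
rewrite -(integral_normal_pdf_shift (X w) (h := fun x => x ^+ (2 * r))).
- by apply: eq_integral => y _; rewrite -opprB exprM sqrrN -exprM.
- exact: exprn_continuous.
- by move=> x; rewrite exprM exprn_ge0 // sqr_ge0.
Qed.

End channel.

(** * Norms *)

Lemma poweR_mulrn (R : realType) (x : \bar R) n : (0 <= x)%E ->
  (x `^ n.+1%:R = x ^+ n.+1)%E.
Proof.
case: x => [x|_|] //.
  by rewrite lee_fin => x0; rewrite poweR_EFin powR_mulrn // EFin_expe.
rewrite poweRyr ?pnatr_eq0 //; elim: n => [|n IH] //.
by rewrite expeS -IH mulyy.
Qed.

(** Hölder's inequality against the constant 1, in the extended reals so that infinite moments are
    covered. The case [q = 1], whose conjugate exponent is not finite, is direct. *)
Lemma lyapunov_Lnorm d (T : measurableType d) (R : realType)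
  (P : probability T R) (X : T -> R) (k q : nat) :
  measurable_fun setT X -> (0 < k)%N -> (0 < q)%N ->
  (\int[P]_w (`|X w| ^+ k)%:E <=
   (\int[P]_w (`|X w| ^+ (k * q))%:E) `^ q%:R^-1)%E.
Proof.
move=> mX k0; case: q => [//|[_|q _]].
  rewrite invr1 poweRe1; last by apply: integral_ge0 => w _; rewrite lee_fin.
  by rewrite muln1.
pose f w := `|X w| ^+ k; pose s : R := q.+2%:R.
have s1 : 1 < s by rewrite ltr1n.
have s0 : 0 < s by rewrite ltr0n.
have t0 : 0 < (1 - s^-1)^-1 by rewrite invr_gt0 subr_gt0 invf_lt1.
have mf : measurable_fun setT f.
  by apply: measurable_funX; apply: measurableT_comp.
have f0 w : 0 <= f w by rewrite exprn_ge0.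
have := @hoelder _ _ _ P f (cst 1) s (1 - s^-1)^-1 mf (measurable_cst _) s0 t0.
rewrite invrK addrC subrK => /(_ erefl).
rewrite (_ : (EFin \o cst 1) = cst 1%E) // Lnorm_cst1 [X in (_ * X `^ _)%E](_ : _ = 1%E);
  last exact: probability_setT.
rewrite poweR1r mule1.
rewrite Lnorm1 unlock => H; apply: le_trans (le_trans _ H) _.
  rewrite le_eqVlt; apply/orP; left; apply/eqP; apply: eq_integral => w _.
  by rewrite /= mulr1 (ger0_norm (f0 w)).
rewrite le_eqVlt; apply/orP; left; apply/eqP; congr (_ `^ _)%E.
apply: eq_integral => w _.
by rewrite /= (ger0_norm (f0 w)) powR_mulrn // /f exprM.
Qed.

(** The claim amounts to [sqrt (8r + 9) >= 5], with equality at [r = 2]. *)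
Lemma q_r_gt0 (R : realType) r : (2 <= r)%N -> (0 < q_r R r)%N.
Proof.
move=> r2; rewrite /q_r truncn_gt0 ler_pdivlMr // lerBrDr mul1r.
have -> : 2 + 3 = Num.sqrt (25 : R).
  by rewrite (_ : 25 = (2 + 3) ^+ 2) ?sqrtr_sqr ?ger0_norm //; lra.
rewrite ler_wsqrtr //.
have : (2 : R) <= r%:R by rewrite ler_nat.
lra.
Qed.

Lemma fact_expn_le m q : (m`! ^ q <= (m * q)`!)%N.
Proof.
elim: q => [|q IH]; first by rewrite expn0 fact_gt0.
have := bin_fact (leq_addr (m * q) m); rewrite addKn mulnS => <-.
rewrite expnS; apply: leq_trans (leq_pmull _ _).
  by rewrite leq_mul2l IH orbT.
by rewrite bin_gt0 leq_addr.
Qed.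

Lemma sqrt_gaussian_moment_le (R : realType) r : (2 <= r)%N ->
  Num.sqrt (gaussian_moment R (2 * r)) <= gamma_r R r.
Proof.
move=> r2; have q0 := q_r_gt0 R r2; set q := q_r R r in q0 *.
have [m0 m2] := gaussian_moment_sqr_le R r; set m := gaussian_moment R _ in m0 m2 *.
have q40 : (0 < 4 * q)%N by rewrite muln_gt0.
(* The power [4q] removes both the square root and the root in [gamma_r]. *)
rewrite -(ler_pXn2r q40) ?nnegrE ?sqrtr_ge0 ?powR_ge0 //.
rewrite -[leRHS]powR_mulrn ?powR_ge0 // -powRrM natrM mulVf; last first.
  by rewrite mulf_neq0 ?pnatr_eq0 // -lt0n.
rewrite powRr1 // exprM (_ : Num.sqrt m ^+ 4 = m ^+ 2); last first.
  by rewrite (exprM _ 2 2) sqr_sqrtr.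
apply: le_trans (_ : ((2 * r)`!)%:R ^+ q <= _).
  by rewrite lerXn2r ?nnegrE ?sqr_ge0.
by rewrite -natrX ler_nat fact_expn_le.
Qed.

Unset Implicit Arguments.
Set Strict Implicit.
Set Printing Implicit Defensive.

Theorem theorem6p1 (R : realType) (d : measure_display) (T : measurableType d)
  (P : probability T R) (X N : T -> R) (r : nat) :
  measurable_fun setT X -> measurable_fun setT N ->
  P.-integrable setT (EFin \o X) ->
  (forall A : set R, measurable A -> P (N @^-1` A) = normal_prob 0 1 A) ->
  indep_rv P X N ->
  (2 <= r)%N ->
  (Lnorm P 2%:E
     (fun w => (derive1n (r - 1) (smoothf P X) (X w + N w))%:E)
   <= ((2 ^+ r * C_const R r)%:E *
       Order.min (gamma_r R r)%:E
         (Lnorm P (2 * r%:R * (q_r R r)%:R)%:E (EFin \o X) ^+ r)))%E.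
Proof.
move=> mX mN _ NQ XN r2; have r0 : (0 < r)%N by rewrite (leq_trans _ r2).
have q0 := q_r_gt0 R r2; set q := q_r R r in q0 *.
set K : R := _ * C_const R r.
have K0 : 0 <= K.
  rewrite mulr_ge0 ?exprn_ge0 //; apply: sumr_ge0 => l _.
  by rewrite /c_lambda !(mulr_ge0, divr_ge0, invr_ge0).
rewrite unlock.
under eq_integral => w _ do
  rewrite abse_EFin poweR_EFin powR_mulrn // real_normK ?num_real // subn1.
set I : \bar R := (\int[P]_w _)%E.
have I0 : (0 <= I)%E by apply: integral_ge0 => w _; rewrite lee_fin sqr_ge0.
have poweR_le (a b : \bar R) (s : R) : 0 <= s -> (0 <= a)%E -> (a <= b)%E ->
    (a `^ s <= b `^ s)%E.
  move=> s0 a0 ab; apply: gt0_ler_poweR => //.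
    by rewrite in_itv /= a0 leey.
  by rewrite in_itv /= (le_trans a0 ab) leey.
have half0 : 0 <= (2^-1 : R) by rewrite invr_ge0.
(* The minimum is one of its two arguments, and each is an upper bound by itself. *)
rewrite minElt; case: ifP => _.
  have [m0 _] := gaussian_moment_sqr_le R r.
  have := integral_derive1n_smoothf_sqr_le_gaussian mX mN NQ XN r2.
  move=> /(poweR_le _ _ _ half0 I0)/le_trans; apply.
  rewrite poweR_EFin -EFinM lee_fin powR12_sqrt; last exact: mulr_ge0 (sqr_ge0 _) m0.
  rewrite sqrtrM ?sqr_ge0 // sqrtr_sqr (ger0_norm K0) ler_wpM2l //.
  exact: sqrt_gaussian_moment_le.
have := integral_derive1n_smoothf_sqr_le_moment mX mN NQ XN r2.
move=> /(poweR_le _ _ _ half0 I0)/le_trans; apply.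
have A0 (n : nat) : (0 <= \int[P]_w (`|X w| ^+ n)%:E)%E.
  by apply: integral_ge0 => w _; rewrite lee_fin.
have -> : (\int[P]_w (X w ^+ (2 * r))%:E = \int[P]_w (`|X w| ^+ (2 * r))%:E)%E.
  by apply: eq_integral => w _; rewrite !exprM real_normK ?num_real.
rewrite poweRM ?lee_fin ?sqr_ge0 // poweR_EFin powR12_sqrt ?sqr_ge0 //.
rewrite sqrtr_sqr (ger0_norm K0) lee_wpmul2l ?lee_fin //.
have k0 : (0 < 2 * r)%N by rewrite muln_gt0.
apply: le_trans (poweR_le _ _ _ half0 (A0 _) (lyapunov_Lnorm P mX k0 q0)) _.
(* Both sides are powers of the same moment, with equal exponents [(1 / q) (1 / 2) = r / (2rq)]. *)
rewrite -poweRrM -(prednK r0) -poweR_mulrn ?poweR_ge0 // -poweRrM prednK //.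
rewrite le_eqVlt; apply/orP; left; apply/eqP; congr (_ `^ _)%E.
  apply: eq_integral => w _; rewrite abse_EFin poweR_EFin.
  by rewrite -!natrM powR_mulrn.
by field; rewrite !pnatr_eq0 -!lt0n q0.
Qed.
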